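(* Consider an $N$-node networked system under star topology with node $l$ ($1\le l\le N$) as the star (centre), i.e. $\beta_{il}\ne0$ for all $i\ne l$ and all other $\beta_{ij}$ (in particular all $\beta_{ii}$) are $0$. For $1\le i\le N$ let $\sigma(A_i)=\{\mu_i^1,\dots,\mu_i^{q_i}\}$ be the set of distinct eigenvalues of $A_i$, let $\gamma_{ij}$ be the geometric multiplicity of $\mu_i^j$ as an eigenvalue of $A_i$, and let $\zeta_{ij}^k\in\mathbb{C}^{1\times n_i}$, $1\le k\le\gamma_{ij}$, be (linearly independent) left eigenvectors of $A_i$ corresponding to $\mu_i^j$. Suppose $H_iC_l=0$ for all $i>l$, and $\zeta_{ij}^kH_iC_l=0$ for all $i<l$, $1\le j\le q_i$ and $1\le k\le\gamma_{ij}$. Then the networked system $\dot X=\mathcal{A}X+\mathcal{B}U$ is controllable if and only if both of the following hold: (i) $(A_i,B_i)$ is a controllable pair for every $1\le i\le N$; (ii) each node is under external control, i.e. $\delta_i\neq0$ for all $i$.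
   Context: A networked system with $N$ nodes is given by data $A_i\in\mathbb{R}^{n_i\times n_i}$, $B_i\in\mathbb{R}^{n_i\times p_i}$, $C_i\in\mathbb{R}^{m\times n_i}$, $H_i\in\mathbb{R}^{n_i\times m}$ (inner-coupling matrices), $\delta_i\in\{0,1\}$ for $1\le i\le N$ ($\delta_i=1$ if node $i$ has an external control input, $0$ otherwise), and real numbers $\beta_{ij}$, $1\le i,j\le N$, where $\beta_{ij}\ne0$ if and only if there is an edge from node $j$ to node $i$. The node dynamics are $\dot x_i=A_ix_i+\sum_{j=1}^N\beta_{ij}H_iC_jx_j+\delta_iB_iu_i$, $y_i=C_ix_i$. In compact form the networked system is $\dot X=\mathcal{A}X+\mathcal{B}U$, where $\mathcal{A}=\mathrm{blockdiag}\{A_1,\dots,A_N\}+(\beta_{ij}H_iC_j)_{i,j=1}^N$ and $\mathcal{B}=\mathrm{blockdiag}\{\delta_1B_1,\dots,\delta_NB_N\}$. A linear system $\dot x=Ax+Bu$ with $A\in\mathbb{R}^{n\times n}$ (equivalently the pair $(A,B)$) is controllable if for any $x_0,x_f\in\mathbb{R}^n$ and any final time $t_f>t_0$ there is an admissible control $u$ on $[t_0,t_f]$ steering $x(t_0)=x_0$ to $x(t_f)=x_f$; equivalently $\mathrm{rank}[B\,|\,AB\,|\cdots|\,A^{n-1}B]=n$. $\sigma(M)$ denotes the set of (complex) eigenvalues of $M$. A left eigenvector of a square matrix $M$ for the eigenvalue $\mu$ is a nonzero row vector $v$ with $vM=\mu v$. *)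

(* Defs.v *)
From HB Require Import structures.
From mathcomp Require Import all_boot all_order all_algebra.
From mathcomp Require Import all_classical all_reals all_analysis.
From mathcomp Require Import complex.

Set Implicit Arguments.
Unset Strict Implicit.
Unset Printing Implicit Defensive.

Import Order.TTheory GRing.Theory Num.Theory.
Import numFieldNormedType.Exports.

Local Open Scope classical_set_scope.
Local Open Scope ring_scope.

(* Admissible controls are the Lebesgue-integrable ones. *)
Definition admissible (R : realType) (p : nat) (t0 tf : R) (u : R -> 'cV[R]_p)
    : Prop :=
  forall i : 'I_p,
    (@lebesgue_measure R).-integrable `[t0, tf] (fun t => (u t i ord0)%:E).

(* x' = A x + B u in the sense of Caratheodory, i.e. in integrated form: u may
   be discontinuous, so x need not be differentiable everywhere.  As x is
   continuous, the integrand is integrable whenever u is admissible. *)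
Definition trajectory (R : realType) (n p : nat) (A : 'M[R]_n)
    (B : 'M[R]_(n, p)) (t0 tf : R) (u : R -> 'cV[R]_p) (x : R -> 'cV[R]_n)
    : Prop :=
  forall i : 'I_n,
    {within `[t0, tf], continuous (fun t => x t i ord0)} /\
    forall t : R, t0 <= t <= tf ->
      x t i ord0 = x t0 i ord0 +
        \int[@lebesgue_measure R]_(s in `[t0, t])
          ((A *m x s + B *m u s) i ord0).

Definition controllable (R : realType) (n p : nat) (A : 'M[R]_n)
    (B : 'M[R]_(n, p)) : Prop :=
  forall (x0 xf : 'cV[R]_n) (t0 tf : R), t0 < tf ->
    exists (u : R -> 'cV[R]_p) (x : R -> 'cV[R]_n),
      [/\ admissible t0 tf u, trajectory A B t0 tf u x,
          x t0 = x0 & x tf = xf].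

(* [mxdiag] only covers square blocks; as there, [conform_mx] is merely a
   cast, the dimensions agree when i = j. *)
Definition blockdiag (R : realType) (N : nat) (n p : 'I_N -> nat)
    (B : forall i, 'M[R]_(n i, p i)) : 'M[R]_(\sum_i n i, \sum_i p i) :=
  \mxblock_(i, j) (if i == j then conform_mx (0 : 'M[R]_(n i, p j)) (B i)
                   else 0).

Definition network_state_mx (R : realType) (N m : nat) (n : 'I_N -> nat)
    (A : forall i, 'M[R]_(n i)) (C : forall i, 'M[R]_(m, n i))
    (H : forall i, 'M[R]_(n i, m)) (beta : 'I_N -> 'I_N -> R)
    : 'M[R]_(\sum_i n i) :=
  \mxdiag_i A i + \mxblock_(i, j) (beta i j *: (H i *m C j)).

Definition network_input_mx (R : realType) (N : nat) (n p : 'I_N -> nat)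
    (B : forall i, 'M[R]_(n i, p i)) (delta : 'I_N -> bool)
    : 'M[R]_(\sum_i n i, \sum_i p i) :=
  blockdiag (fun i => (delta i)%:R *: B i).

Definition star_topology (R : realType) (N : nat) (beta : 'I_N -> 'I_N -> R)
    (l : 'I_N) : Prop :=
  (forall i, i != l -> beta i l != 0) /\
  (forall i j, ~~ ((j == l) && (i != l)) -> beta i j = 0).

Definition complexmx (R : realType) (m n : nat) (M : 'M[R]_(m, n))
    : 'M[R[i]]_(m, n) :=
  map_mx (real_complex R) M.

Definition left_eigenvector (F : fieldType) (n : nat) (M : 'M[F]_n) (mu : F)
    (v : 'rV[F]_n) : Prop :=
  v != 0 /\ v *m M = mu *: v.

(* [eigenspace] is the space of left (row) eigenvectors; it has the same
   dimension as the space of right ones. *)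
Definition geometric_multiplicity (F : fieldType) (n : nat) (M : 'M[F]_n)
    (mu : F) : nat :=
  \rank (eigenspace M mu).

(* Main.v *)
Require Import Defs.
From mathcomp Require Import all_boot all_order all_algebra.
From mathcomp Require Import all_classical all_reals all_analysis.
From mathcomp Require Import complex.
From mathcomp Require Import ring.

Set Implicit Arguments.
Unset Strict Implicit.
Unset Printing Implicit Defensive.

Import Order.TTheory GRing.Theory Num.Theory.
Import numFieldNormedType.Exports.

Local Open Scope ring_scope.

(** Controllability is tested on left eigenvectors (Hautus): [(A, B)] is
    controllable exactly when no nonzero complex row vector [v] satisfies both
    [v A = mu v] and [v B = 0] (lemma [hautus_test]).

    In a star network with centre [l] the state matrix is the block diagonal of
    the [A_i] plus coupling blocks in block column [l] only.  Let
    [v = (v_1, .., v_N)] be a left eigenvector.  The columns other than [l] say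
    that each [v_i] with [i <> l] is zero or a left eigenvector of [A_i], hence
    a combination of the [zeta_ij]; so [v_i H_i C_l = 0], by the hypothesis on
    the [zeta_ij] when [i < l] and trivially when [i > l].  The coupling thus
    vanishes on [v], and the left eigenvectors of the network are those of the
    uncoupled block diagonal system.  As the input matrix is block diagonal
    too, the Hautus test for the network is the conjunction of the tests for
    the pairs [(A_i, delta_i B_i)]; such a test fails if [delta_i = 0], because
    [A_i] has an eigenvector.

    The Hautus test itself has two halves.

    Necessity ([controllable_no_mode]): if [v A = mu v] and [v B = 0], then
    along every trajectory [y = v x] solves [y' = mu y] whatever the control
    is, so [y] stays at [0] once it starts there ([planar_ode_zero]); as
    every state is reachable from [0], [v = 0].

    Sufficiency ([no_mode_controllable]): without such a [v] there are matrices
    [K_k] with [1 = \sum_k A^k B K_k] ([kalman_alternative],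
    [annihilator_mode]).  These give polynomial controls, with neither matrix
    exponentials nor Gramians.  Join the two states by a polynomial path [x]
    whose defect [e = x' - A x] vanishes to high order at both end points
    ([approx_path]).  For every [f], the difference [f^(k) - A^k f] has the form
    [w' - A w] with [w] built from the first [k - 1] derivatives of [f]
    ([shift_to_deriv]).  With [f = B K_k e] and a sum over [k], adding the [w]s
    to [x] turns the defect into [B \sum_k K_k e^(k)], which the control
    [u = \sum_k K_k e^(k)] supplies, while the end points do not move. *)

(** * Polynomial vector functions and polynomial steering *)

Section PolynomialVectors.
Variable F : numFieldType.
Implicit Types (g : {poly F}) (n p : nat).

Notation "A ^:C" := (map_mx polyC A) (at level 2).
Notation D := (@map_mx {poly F} {poly F} (@deriv F) _ _).

Definition derivn_pvec k n (v : 'cV[{poly F}]_n) : 'cV[{poly F}]_n :=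
  iter k D v.

Definition pvec_dvd n g (v : 'cV[{poly F}]_n) : Prop := forall i, g %| v i 0.

Definition pvec_eval n (v : 'cV[{poly F}]_n) (t : F) : 'cV[F]_n :=
  \col_i (v i 0).[t].

Lemma deriv_constmul n p (A : 'M[F]_(n, p)) (v : 'cV[{poly F}]_p) :
  D (A^:C *m v) = A^:C *m D v.
Proof.
apply/matrixP => i j; rewrite !mxE raddf_sum /=; apply: eq_bigr => k _.
by rewrite !mxE derivM derivC mul0r add0r.
Qed.

Lemma dvdp_deriv g (f : {poly F}) k : g ^+ k.+1 %| f -> g ^+ k %| f^`().
Proof.
move=> /dvdpP[h ->]; rewrite derivM deriv_exp /= dvdp_add //.
  by rewrite dvdp_mull // exprS dvdp_mull.
by rewrite dvdp_mull // -mulrnAr dvdp_mull // -mulr_natl dvdp_mull.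
Qed.

Lemma pvec_eval_root n g (v : 'cV[{poly F}]_n) t :
  root g t -> pvec_dvd g v -> pvec_eval v t = 0.
Proof.
move=> gt0 gv; apply/matrixP => i j; rewrite !mxE.
by apply/eqP; rewrite -[_ == 0]/(root _ t); apply: root_dvdp gt0.
Qed.

Lemma pvec_evalD n (v w : 'cV[{poly F}]_n) t :
  pvec_eval (v + w) t = pvec_eval v t + pvec_eval w t.
Proof. by apply/matrixP => i j; rewrite !mxE hornerD. Qed.

Lemma pvec_eval_constmul n p (A : 'M[F]_(n, p)) (v : 'cV[{poly F}]_p) t :
  pvec_eval (A^:C *m v) t = A *m pvec_eval v t.
Proof.
apply/matrixP => i j; rewrite !mxE horner_sum; apply: eq_bigr => k _.
by rewrite !mxE hornerM hornerC.
Qed.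

(** The path is improved one order of contact at a time.  With
    [g = (X - a)(X - b)] and defect [g^M r], subtracting [g^(M+1) c] keeps the
    end points and changes the defect to [g^M (r - (M+1) g' c)] modulo
    [g^(M+1)].  Since [g'] is invertible modulo [g], a suitable [c] cancels [r]
    modulo [g]. *)
Lemma approx_path n (A : 'M[F]_n) (x0 x1 : 'cV[F]_n) a b M : a != b ->
  exists x : 'cV[{poly F}]_n,
    [/\ pvec_dvd ((('X - a%:P) * ('X - b%:P)) ^+ M) (D x - A^:C *m x),
        pvec_eval x a = x0 & pvec_eval x b = x1].
Proof.
move=> ab; have ba0 : b - a != 0 by rewrite subr_eq0 eq_sym.
set g := _ * _.
have ga : root g a by rewrite rootM root_XsubC eqxx.
have gb : root g b by rewrite rootM !root_XsubC eqxx orbT.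
elim: M => [|M [x [dx xa xb]]].
  (* order zero asks nothing of the defect: the straight segment will do *)
  exists (\col_i (x0 i 0)%:P + ((b - a)^-1%:P * ('X - a%:P)) *:
            \col_i (x1 i 0 - x0 i 0)%:P).
  split; first by move=> i; rewrite expr0 dvd1p.
    apply/matrixP => i j; rewrite (ord1 j) !mxE !hornerE.
    by rewrite subrr mulr0 mul0r addr0.
  apply/matrixP => i j; rewrite (ord1 j) !mxE !hornerE mulVf // mul1r.
  by rewrite addrCA subrr addr0.
have {dx} [r dx] : exists r, D x - A^:C *m x = g ^+ M *: r.
  exists (\col_i ((D x - A^:C *m x) i 0 %/ g ^+ M)).
  apply/matrixP => i j.
  by rewrite (ord1 j) [RHS]mxE mulrC [X in X * _]mxE divpK.
(* [g'^2] is the discriminant of [g] modulo [g], which makes the inverse of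
   [g'] modulo [g] explicit *)
have g'2 : g^`() * g^`() = 4%:P * g + ((b - a) ^+ 2)%:P.
  rewrite /g derivM !derivXsubC rmorphXn rmorphB /= rmorph_nat; ring.
pose c := (((M.+1)%:R * (b - a) ^+ 2)^-1)%:P * g^`() *: r.
exists (x - g ^+ M.+1 *: c); split; last 2 first.
- rewrite pvec_evalD xa (@pvec_eval_root _ _ _ _ ga) ?addr0 // => i.
  by rewrite !mxE dvdpNr exprS -mulrA dvdp_mulr.
- rewrite pvec_evalD xb (@pvec_eval_root _ _ _ _ gb) ?addr0 // => i.
  by rewrite !mxE dvdpNr exprS -mulrA dvdp_mulr.
have -> : D (x - g ^+ M.+1 *: c) - A^:C *m (x - g ^+ M.+1 *: c) =
    g ^+ M.+1 *: (A^:C *m c - D c - (4 / (b - a) ^+ 2)%:P *: r).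
  have -> : D (x - g ^+ M.+1 *: c) =
      D x - (g ^+ M.+1 *: D c + (g ^+ M * g^`() *+ M.+1) *: c).
    apply/matrixP => i j; rewrite !mxE derivB derivM deriv_exp /=.
    by rewrite -mulrnAr mulrnAr; congr (_ - _); rewrite addrC (mulrC g^`()).
  rewrite mulmxBr -scalemxAr.
  rewrite (_ : D x = g ^+ M *: r + A^:C *m x); last by rewrite -dx subrK.
  have key : (g ^+ M * g^`() *+ M.+1) *: c =
      g ^+ M.+1 *: ((4 / (b - a) ^+ 2)%:P *: r) + g ^+ M *: r.
    rewrite /c !scalerA -scalerDl; congr (_ *: _).
    rewrite -[_ *+ _]mulr_natr; set d := (b - a) in ba0 g'2 *.
    have m0 : (M.+1)%:R != 0 :> F by rewrite pnatr_eq0.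
    have e1 : (M.+1)%:R * ((M.+1)%:R * d ^+ 2)^-1%:P * d%:P ^+ 2 = 1
        :> {poly F}.
      rewrite -polyC_natr -polyC_exp -!polyCM -[RHS]polyC1; congr polyC.
      by move: m0; move: (M.+1)%:R => m m0; field; rewrite ba0 ?m0.
    have e2 : (4 / d ^+ 2)%:P =
        4%:P * (M.+1)%:R * ((M.+1)%:R * d ^+ 2)^-1%:P :> {poly F}.
      rewrite -polyC_natr -!polyCM; congr polyC.
      by move: m0; move: (M.+1)%:R => m m0; field; rewrite ba0 ?m0.
    rewrite e2.
    have -> : g ^+ M * g^`() * (M.+1)%:R *
          (((M.+1)%:R * d ^+ 2)^-1%:P * g^`()) =
        g ^+ M * (M.+1)%:R * ((M.+1)%:R * d ^+ 2)^-1%:P * (g^`() * g^`()).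
      by ring.
    rewrite g'2 polyC_exp.
    rewrite -[X in _ = _ + X]mulr1 -[X in _ = _ + _ * X]e1.
    rewrite (exprS g M); ring.
  rewrite key !scalerBr; move: (g ^+ M *: r) (A^:C *m x) (g ^+ M.+1 *: D c).
  move: (_ *: _) (_ *: _) => y1 y2 y3 y4 y5.
  apply/matrixP => i j; rewrite !mxE; ring.
by move=> i; rewrite mxE dvdp_mulr.
Qed.

Lemma pvec_dvd_trans n (v : 'cV[{poly F}]_n) g h :
  h %| g -> pvec_dvd g v -> pvec_dvd h v.
Proof. by move=> hg gv i; apply: dvdp_trans (gv i). Qed.

Lemma pvec_dvd_constmul n p (A : 'M[F]_(n, p)) (v : 'cV[{poly F}]_p) g :
  pvec_dvd g v -> pvec_dvd g (A^:C *m v).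
Proof.
move=> gv i; rewrite mxE; apply: (big_ind (fun q => g %| q)) => //.
- exact: dvdp_add.
- by move=> k _; rewrite dvdp_mull.
Qed.

Lemma pvec_dvd_deriv_iter n (v : 'cV[{poly F}]_n) g k j :
  pvec_dvd (g ^+ (k + j)) v -> pvec_dvd (g ^+ j) (derivn_pvec k v).
Proof.
elim: k j => // k IHk j gv i; rewrite [derivn_pvec _ _]iterS mxE dvdp_deriv //.
by apply: IHk; rewrite addnS.
Qed.

Lemma deriv_iter_constmul n p (A : 'M[F]_(n, p)) (v : 'cV[{poly F}]_p) k :
  derivn_pvec k (A^:C *m v) = A^:C *m derivn_pvec k v.
Proof.
elim: k => // k IHk.
by rewrite [LHS]iterS -/(derivn_pvec k _) IHk deriv_constmul.
Qed.

(** As [d/dt] and [A] commute, [d/dt - A] divides [(d/dt)^k - A^k].  Applied to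
    [f], the quotient [w_k] satisfies [w_(k+1) = A w_k + f^(k)], and involves only derivatives of [f] of
    order less than [k], which vanish at the roots of [g] when [g^k] divides
    [f]. *)
Lemma shift_to_deriv n (A : 'M[F]_n.+1) g k (f : 'cV[{poly F}]_n.+1) :
  pvec_dvd (g ^+ k) f ->
  exists w : 'cV[{poly F}]_n.+1,
    D w - A^:C *m w = derivn_pvec k f - (A ^+ k)^:C *m f /\
    (forall t, root g t -> pvec_eval w t = 0).
Proof.
elim: k => [_|k IHk gf].
  exists 0; split=> [|t _].
    by rewrite expr0 map_mx1 mul1mx mulmx0 raddf0 !subrr.
  by apply/matrixP => i j; rewrite !mxE horner0.
have [|w [dw w0]] := IHk.
  by apply: pvec_dvd_trans gf; rewrite dvdp_exp2l.
exists (A^:C *m w + derivn_pvec k f); split=> [|t gt]; last first.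
  rewrite pvec_evalD pvec_eval_constmul w0 // mulmx0 add0r.
  apply: (pvec_eval_root gt); rewrite -(expr1 g).
  by apply: pvec_dvd_deriv_iter; rewrite addn1.
rewrite raddfD /= deriv_constmul mulmxDr opprD addrACA -mulmxBr dw mulmxBr.
by rewrite (exprS A k) -mulmxE map_mxM -mulmxA addrC addrA subrK.
Qed.

(** The identity [1 = \sum_k A^k B K_k] splits the defect of a path into parts
    [A^k (B K_k e)]; each is traded for [B K_k e^(k)], which lies in the range
    of [B]. *)
Lemma polynomial_steering n p (A : 'M[F]_n.+1) (B : 'M[F]_(n.+1, p)) N
    (K : 'I_N -> 'M[F]_(p, n.+1)) (x0 x1 : 'cV[F]_n.+1) a b :
    a != b -> 1%:M = \sum_(k < N) A ^+ k *m B *m K k ->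
  exists (x : 'cV[{poly F}]_n.+1) (u : 'cV[{poly F}]_p),
    [/\ D x = A^:C *m x + B^:C *m u,
        pvec_eval x a = x0 & pvec_eval x b = x1].
Proof.
move=> ab sumK; have [x [gx xa xb]] := approx_path A x0 x1 N ab.
move: gx; set g := _ * _; set e := _ - _ => ge.
have ga : root g a by rewrite rootM root_XsubC eqxx.
have gb : root g b by rewrite rootM !root_XsubC eqxx orbT.
have /choice[w wP] (k : 'I_N) : exists w : 'cV[{poly F}]_n.+1,
    D w - A^:C *m w =
      derivn_pvec k ((B *m K k)^:C *m e) -
        (A ^+ k)^:C *m ((B *m K k)^:C *m e) /\
    (forall t, root g t -> pvec_eval w t = 0).
  apply: shift_to_deriv; apply/pvec_dvd_constmul/pvec_dvd_trans/ge.
  by rewrite dvdp_exp2l // ltnW.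
have w0 t : root g t -> pvec_eval (\sum_k w k) t = 0.
  move=> gt; apply: (big_ind (fun v => pvec_eval v t = 0)).
  - by apply/matrixP => i j; rewrite !mxE horner0.
  - by move=> u v; rewrite pvec_evalD => -> ->; rewrite addr0.
  - by move=> k _; have [_ ->] := wP k.
exists (x + \sum_k w k), (\sum_k (K k)^:C *m derivn_pvec k e).
split; rewrite ?pvec_evalD ?w0 ?addr0 //.
apply/eqP; rewrite [eqbRHS]addrC -subr_eq mulmxDr opprD raddfD /= addrACA -/e.
apply/eqP; rewrite raddf_sum /= mulmx_sumr -sumrB.
rewrite (eq_bigr _ (fun k _ => (wP k).1)).
under eq_bigr => k _ do rewrite deriv_iter_constmul.
rewrite sumrB mulmx_sumr [X in _ - X](_ : _ = e); last first.
  under eq_bigr => k _ do rewrite mulmxA -map_mxM mulmxA.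
  by rewrite -mulmx_suml -map_mx_sum -sumK map_mx1 mul1mx.
by rewrite addrC subrK; apply: eq_bigr => k _; rewrite map_mxM mulmxA.
Qed.

End PolynomialVectors.

(** * Uncontrollable modes and the Kalman identity *)

(** The vectors [v q(A)], [q] a polynomial, all annihilate [B].  Factor a
    polynomial [q] with [v q(A) = 0] into linear factors and remove them one by
    one: the last nonzero [v r(A)] is an eigenvector. *)
Lemma annihilator_mode (F : closedFieldType) n p (A : 'M[F]_n.+1)
    (B : 'M[F]_(n.+1, p)) (v : 'rV[F]_n.+1) :
  v != 0 -> (forall k, v *m A ^+ k *m B = 0) ->
  exists (mu : F) (w : 'rV[F]_n.+1),
    [/\ w != 0, w *m A = mu *: w & w *m B = 0].
Proof.
move=> v0 vB.
have vqB q : v *m horner_mx A q *m B = 0.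
  rewrite -[q]coefK poly_def raddf_sum /= mulmx_sumr mulmx_suml.
  apply: big1 => i _.
  rewrite linearZ /= rmorphXn /= horner_mx_X.
  by rewrite -scalemxAr -scalemxAl vB scaler0.
(* induction on the size of the annihilating polynomial, starting from the
   characteristic polynomial *)
suff H m (q : {poly F}) : (size q < m)%N -> q != 0 -> v *m horner_mx A q = 0 ->
    exists (mu : F) (w : 'rV[F]_n.+1),
      [/\ w != 0, w *m A = mu *: w & w *m B = 0].
  apply: (H _ _ (leqnn (size (char_poly A)).+1)).
    exact/monic_neq0/char_poly_monic.
  by rewrite Cayley_Hamilton mulmx0.
elim: m q => // m IHm q qm q0 vq.
have [/size_poly1P[c c0 qc]|] := boolP (size q == 1%N).
  move: vq; rewrite qc horner_mx_C mul_mx_scalar => /eqP.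
  by rewrite scaler_eq0 (negPf c0) (negPf v0).
case/closed_rootP=> mu /factor_theorem[r qr].
have [r0|w0] := eqVneq (v *m horner_mx A r) 0.
  have rN0 : r != 0 by apply: contraNneq q0 => r0'; rewrite qr r0' mul0r.
  apply: (IHm r) => //.
  by move: qm; rewrite qr size_Mmonic ?monicXsubC ?size_XsubC ?addn2.
exists mu, (v *m horner_mx A r); split=> //; apply/eqP; rewrite -subr_eq0.
rewrite -mul_mx_scalar -mulmxBr; apply/eqP; move: vq.
by rewrite qr rmorphM /= rmorphB /= horner_mx_X horner_mx_C -mulmxE mulmxA.
Qed.

Lemma expmx_Cayley_Hamilton (F : fieldType) n (A : 'M[F]_n.+1) k :
  exists c : 'I_n.+1 -> F, A ^+ k = \sum_i c i *: A ^+ i.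
Proof.
pose r := 'X^k %% char_poly A.
have Xk : A ^+ k = horner_mx A r.
  rewrite -{1}(horner_mx_X A) -rmorphXn /= {1}(divp_eq 'X^k (char_poly A)).
  by rewrite rmorphD rmorphM /= Cayley_Hamilton mulr0 add0r.
have sr : (size r <= n.+1)%N.
  rewrite -ltnS -[n.+2](size_char_poly A) ltn_modp.
  by rewrite monic_neq0 ?char_poly_monic.
have rE : r = \sum_(i < n.+1) r`_i *: 'X^i.
  rewrite -poly_def; apply/polyP => i; rewrite coef_poly.
  by case: ltnP => // ni; rewrite nth_default // (leq_trans sr).
exists (fun i => r`_i); rewrite Xk {1}rE raddf_sum /=; apply: eq_bigr => i _.
by rewrite linearZ /= rmorphXn /= horner_mx_X.
Qed.

(** Either the columns of the Kalman matrix [B | A B | .. | A^(n-1) B] span the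
    whole space, which the matrices [K k] express in coordinates, or a nonzero
    row vector annihilates them, and then it annihilates all [A^k B] by
    Cayley-Hamilton. *)
Lemma kalman_alternative (F : fieldType) n p (A : 'M[F]_n.+1)
    (B : 'M[F]_(n.+1, p)) :
  (exists K : 'I_n.+1 -> 'M[F]_(p, n.+1),
     1%:M = \sum_(k < n.+1) A ^+ k *m B *m K k) \/
  exists2 v : 'rV[F]_n.+1, v != 0 & forall k, v *m A ^+ k *m B = 0.
Proof.
pose U := (\sum_(k < n.+1) <<(A ^+ k *m B)^T>>)%MS.
have [/mxalgebra.sub_sums_genmxP[u eu]|U1] := boolP (1%:M <= U)%MS.
  left; exists (fun k => (u k)^T); rewrite -[LHS]trmx1 eu raddf_sum /=.
  by apply: eq_bigr => k _; rewrite trmx_mul trmxK.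
right; have /rowV0Pn[v] : (cokermx U)^T != 0.
  by rewrite -[0]trmx0 (can_eq (@trmxK _ _ _)) cokermx_eq0 -sub1mx.
case/submxP=> w vE v0; exists v => //.
have vk (k : 'I_n.+1) : v *m A ^+ k *m B = 0.
  have : (<<(A ^+ k *m B)^T>> <= U)%MS by rewrite (sumsmx_sup k).
  rewrite genmxE => /submxP[D eD].
  rewrite -mulmxA -[A ^+ k *m B]trmxK vE -mulmxA -trmx_mul eD.
  by rewrite -mulmxA mulmx_coker mulmx0 trmx0 mulmx0.
move=> k; have [c ->] := expmx_Cayley_Hamilton A k.
rewrite mulmx_sumr mulmx_suml; apply: big1 => i _.
by rewrite -scalemxAr -scalemxAl vk scaler0.
Qed.

(** * Integrals along trajectories *)

Local Open Scope classical_set_scope.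

Section Analysis.
Variable R : realType.
Notation leb := (@lebesgue_measure R).

Lemma Rintegral_deriv_poly (P : {poly R}) (a t : R) : a <= t ->
  \int[leb]_(s in `[a, t]) P^`().[s] = P.[t] - P.[a].
Proof.
rewrite le_eqVlt => /predU1P[<-|at_].
  by rewrite set_itv1 Rintegral_set1 subrr.
rewrite /Rintegral (@continuous_FTC2 _ _ (horner P)) //.
- by apply: continuous_subspaceT => x; exact: continuous_horner.
- split=> [x _||]; first exact: derivable_horner.
    by apply: cvg_at_right_filter; exact: continuous_horner.
  by apply: cvg_at_left_filter; exact: continuous_horner.
- by move=> x _; rewrite derivE.
Qed.

Lemma integrable_within_continuous (f : R -> R) (a b : R) :
  {within `[a, b], continuous f} -> leb.-integrable `[a, b] (EFin \o f).
Proof. by apply: continuous_compact_integrable; exact: segment_compact. Qed.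

Lemma within_continuous_lincomb n (c : 'I_n -> R) (f : 'I_n -> R -> R)
    (D : set R) :
  (forall i, {within D, continuous (f i)}) ->
  {within D, continuous (fun s => \sum_i c i * f i s)}.
Proof.
move=> cf; elim: (index_enum _) => [|i r IHr].
  under eq_fun do rewrite big_nil.
  by move=> x; exact: cst_continuous.
under eq_fun do rewrite big_cons.
move=> x; apply: (continuousD _ (IHr x)).
by apply: continuousM; [exact: cst_continuous|exact: cf].
Qed.

Section LinearCombination.
Context d (T : measurableType d) (mu : {measure set T -> \bar R}).
Variables (D : set T) (mD : measurable D).

Lemma integrable_lincomb I (r : seq I) (c : I -> R) (f : I -> T -> R) :
  (forall i, mu.-integrable D (EFin \o f i)) ->
  mu.-integrable D (EFin \o (fun s => \sum_(i <- r) c i * f i s)).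
Proof.
move=> fi; under [_ \o _]eq_fun do rewrite /= -sumEFin.
apply: integrable_sum => // i _.
have := integrableZl mD (c i) (fi i).
by apply: eq_integrable => // s _ /=; rewrite EFinM.
Qed.

Lemma Rintegral_lincomb I (r : seq I) (c : I -> R) (f : I -> T -> R) :
  (forall i, mu.-integrable D (EFin \o f i)) ->
  \int[mu]_(s in D) (\sum_(i <- r) c i * f i s) =
  \sum_(i <- r) c i * \int[mu]_(s in D) f i s.
Proof.
move=> fi; elim: r => [|i r IHr].
  under eq_Rintegral => s _ do rewrite big_nil.
  by rewrite Rintegral_cst // mul0r big_nil.
under eq_Rintegral => s _ do rewrite big_cons.
rewrite big_cons -IHr -RintegralZl // RintegralD //.
  have := integrableZl mD (c i) (fi i).
  by apply: eq_integrable => // s _ /=; rewrite EFinM.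
exact: integrable_lincomb.
Qed.

End LinearCombination.

(** This is [y' = (al + be i) y] with [y = y1 + y2 i] and [y(t0) = 0], in
    integrated form: [|y|^2 e^(-2 al t)] has derivative zero, so it keeps its
    initial value. *)
Lemma planar_ode_zero (al be t0 tf : R) (y1 y2 : R -> R) : t0 < tf ->
  {within `[t0, tf], continuous y1} -> {within `[t0, tf], continuous y2} ->
  (forall t, t0 <= t <= tf ->
     y1 t = \int[leb]_(s in `[t0, t]) (al * y1 s - be * y2 s)) ->
  (forall t, t0 <= t <= tf ->
     y2 t = \int[leb]_(s in `[t0, t]) (al * y2 s + be * y1 s)) ->
  y1 tf = 0 /\ y2 tf = 0.
Proof.
move=> t0f c1 c2 e1 e2.
pose f1 s := al * y1 s - be * y2 s; pose f2 s := al * y2 s + be * y1 s.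
pose F1 t := \int[leb]_(s in `[t0, t]) f1 s.
pose F2 t := \int[leb]_(s in `[t0, t]) f2 s.
have cM (k : R) (y : R -> R) : {within `[t0, tf], continuous y} ->
    {within `[t0, tf], continuous (fun s => k * y s)}.
  by move=> cy x; apply: continuousM => //; [exact: cst_continuous|exact: cy].
have cf1 : {within `[t0, tf], continuous f1}.
  by move=> x; exact: (continuousB (cM al _ c1 x) (cM be _ c2 x)).
have cf2 : {within `[t0, tf], continuous f2}.
  by move=> x; exact: (continuousD (cM al _ c2 x) (cM be _ c1 x)).
(* [y1] and [y2] are known only on the interval; the integrals [F1] and [F2]
   agree with them there and have derivatives in its interior *)
have dF (f : R -> R) : {within `[t0, tf], continuous f} ->
    forall x, x \in `]t0, tf[%R ->
    is_derive x 1 (fun t => \int[leb]_(s in `[t0, t]) f s) (f x).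
  move=> cf x xt; have [cfo _ _] := (continuous_within_itvP f t0f).1 cf.
  have /andP[ax xb] : t0 < x < tf by move: xt; rewrite in_itv.
  have [dd de] := continuous_FTC1_closed xb (integrable_within_continuous cf)
    ax (cfo x xt).
  by apply: DeriveDef => //; rewrite -derive1E.
have FE (y f : R -> R) : {within `[t0, tf], continuous y} ->
    (forall t, t0 <= t <= tf -> y t = \int[leb]_(s in `[t0, t]) f s) ->
    {within `[t0, tf], continuous (fun t => \int[leb]_(s in `[t0, t]) f s)}.
  move=> cy ye; apply: subspace_eq_continuous cy => t.
  by rewrite inE /= in_itv /= => /ye.
have F1E t : t0 <= t <= tf -> F1 t = y1 t by move=> /e1 ->.
have F2E t : t0 <= t <= tf -> F2 t = y2 t by move=> /e2 ->.
pose E : R -> R := fun t : R => expR ((- (2 * al)) * t).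
pose G t := (F1 t * F1 t + F2 t * F2 t) * E t.
have dE (x : R) : is_derive x 1 E (- (2 * al) * E x).
  by apply: is_derive_eq; rewrite [_%:A]mulr1 mulrC.
have dG (x : R) : x \in `]t0, tf[%R -> is_derive x 1 G 0.
  move=> xt; have d1 : is_derive x 1 F1 (f1 x) := dF _ cf1 _ xt.
  have d2 : is_derive x 1 F2 (f2 x) := dF _ cf2 _ xt.
  have dEx := dE x.
  have xt' : t0 <= x <= tf.
    by move: xt; rewrite in_itv /= => /andP[/ltW -> /ltW ->].
  apply: is_derive_eq.
  by rewrite /GRing.scale /= /f1 /f2 !F1E // !F2E //; ring.
have cG : {within `[t0, tf], continuous G}.
  have cF1 : {within `[t0, tf], continuous F1} by apply: FE c1 e1.
  have cF2 : {within `[t0, tf], continuous F2} by apply: FE c2 e2.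
  have cE : continuous E.
    by move=> x; apply/differentiable_continuous/derivable1_diffP; case: (dE x).
  have cE' : {within `[t0, tf], continuous E} by exact: continuous_subspaceT.
  move=> x.
  exact: (continuousM (continuousD (continuousM (cF1 x) (cF1 x))
    (continuousM (cF2 x) (cF2 x))) (cE' x)).
have [c _] := MVT t0f dG cG; rewrite mul0r => /eqP; rewrite subr_eq0 => /eqP.
have F0 f : \int[leb]_(s in `[t0, t0]) f s = 0.
  by rewrite set_itv1 Rintegral_set1.
rewrite {2}/G /F1 /F2 !F0 mulr0 addr0 mul0r => /eqP.
rewrite mulf_eq0 (gt_eqF (expR_gt0 _)) orbF -!expr2 paddr_eq0 ?sqr_ge0 //.
rewrite !sqrf_eq0 => /andP[/eqP z1 /eqP z2].
by rewrite -F1E ?lexx ?ltW // -F2E ?lexx ?ltW.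
Qed.

(** A functional annihilating [B] does not see the control: along a trajectory
    it satisfies an integral equation in the state alone. *)
Lemma trajectory_functional n p (A : 'M[R]_n) (B : 'M[R]_(n, p)) t0 tf u x
    (c : 'rV[R]_n) :
  admissible t0 tf u -> trajectory A B t0 tf u x -> c *m B = 0 ->
  {within `[t0, tf], continuous (fun t => (c *m x t) 0 0)} /\
  forall t, t0 <= t <= tf ->
    (c *m x t) 0 0 =
      (c *m x t0) 0 0 + \int[leb]_(s in `[t0, t]) (c *m A *m x s) 0 0.
Proof.
move=> adm traj cB; split.
  rewrite (_ : (fun t => _) = fun t => \sum_i c 0 i * x t i 0); last first.
    by apply/funext => t; rewrite mxE.
  by apply: within_continuous_lincomb => i; have [] := traj i.
move=> t t0f; rewrite ![in LHS]mxE.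
have sub : `[t0, t] `<=` `[t0, tf].
  by apply: subset_itvl; rewrite bnd_simp; case/andP: t0f.
have xi i : leb.-integrable `[t0, t] (EFin \o (fun s => x s i 0)).
  apply: (@integrableS _ _ _ leb `[t0, tf]) => //.
  by apply: integrable_within_continuous; have [] := traj i.
have ui i : leb.-integrable `[t0, t] (EFin \o (fun s => u s i 0)).
  by apply: (@integrableS _ _ _ leb `[t0, tf]) => //; exact: adm.
under eq_bigr => i _ do rewrite (traj i).2 // mulrDr.
rewrite big_split /= [in RHS]mxE; congr (_ + _).
rewrite -Rintegral_lincomb //.
  apply: eq_Rintegral => s _.
  have -> : c *m A *m x s = c *m (A *m x s + B *m u s).
    by rewrite mulmxDr !mulmxA cB mul0mx addr0.
  by rewrite [in RHS]mxE.
move=> i; under [_ \o _]eq_fun do rewrite /= !mxE EFinD.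
by apply: integrableD => //; exact: integrable_lincomb.
Qed.

(** * The Hautus test *)

Lemma map_Re_mulmx m n p (v : 'M[R[i]]_(m, n)) (M : 'M[R]_(n, p)) :
  map_mx (@complex.Re R) (v *m complexmx M) = map_mx (@complex.Re R) v *m M.
Proof.
apply/matrixP => i j; rewrite !mxE.
rewrite (big_morph (@complex.Re R) (id1 := 0) (op1 := +%R)) //; last first.
  by move=> [a b] [c d].
apply: eq_bigr => k _; rewrite !mxE.
by case: (v i k) => a b /=; rewrite mulr0 subr0.
Qed.

Lemma map_Im_mulmx m n p (v : 'M[R[i]]_(m, n)) (M : 'M[R]_(n, p)) :
  map_mx (@complex.Im R) (v *m complexmx M) = map_mx (@complex.Im R) v *m M.
Proof.
apply/matrixP => i j; rewrite !mxE.
rewrite (big_morph (@complex.Im R) (id1 := 0) (op1 := +%R)) //; last first.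
  by move=> [a b] [c d].
apply: eq_bigr => k _; rewrite !mxE.
by case: (v i k) => a b /=; rewrite mulr0 add0r.
Qed.

(** The output [v x] evolves by [y' = mu y] independently of the control, so no
    state outside the kernel of [v] is reachable from [0]. *)
Lemma controllable_no_mode n p (A : 'M[R]_n) (B : 'M[R]_(n, p)) (mu : R[i])
    (v : 'rV[R[i]]_n) :
  controllable A B -> v *m complexmx A = mu *: v -> v *m complexmx B = 0 ->
  v = 0.
Proof.
move=> ctrl vA vB.
pose a := map_mx (@complex.Re R) v; pose b := map_mx (@complex.Im R) v.
have aB : a *m B = 0.
  by rewrite -map_Re_mulmx vB; apply/matrixP => i j; rewrite !mxE.
have bB : b *m B = 0.
  by rewrite -map_Im_mulmx vB; apply/matrixP => i j; rewrite !mxE.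
have aA : a *m A = complex.Re mu *: a - complex.Im mu *: b.
  rewrite -map_Re_mulmx vA; apply/matrixP => i j; rewrite !mxE.
  by case: (mu) (v i j) => [? ?] [? ?].
have bA : b *m A = complex.Re mu *: b + complex.Im mu *: a.
  rewrite -map_Im_mulmx vA; apply/matrixP => i j; rewrite !mxE.
  by case: (mu) (v i j) => [? ?] [? ?] /=.
suff ab0 (w : 'cV[R]_n) : (a *m w) 0 0 = 0 /\ (b *m w) 0 0 = 0.
  apply/rowP => i; have [] := ab0 (delta_mx i 0).
  by rewrite -!colE !mxE; case: (v 0 i) => /= ? ? -> ->.
have [u [x [adm traj x0 xw]]] := ctrl 0 w 0 1 ltr01.
rewrite -xw.
have [ca ea] := trajectory_functional adm traj aB.
have [cb eb] := trajectory_functional adm traj bB.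
apply: (planar_ode_zero (al := complex.Re mu) (be := complex.Im mu)
  (y1 := fun t => (a *m x t) 0 0) (y2 := fun t => (b *m x t) 0 0) ltr01 ca cb).
- move=> t t01; rewrite ea // x0 mulmx0 mxE add0r; apply: eq_Rintegral => s _.
  by rewrite aA mulmxBl -!scalemxAl !mxE.
- move=> t t01; rewrite eb // x0 mulmx0 mxE add0r; apply: eq_Rintegral => s _.
  by rewrite bA mulmxDl -!scalemxAl !mxE.
Qed.

End Analysis.

Lemma polynomial_trajectory (R : realType) n p (A : 'M[R]_n) (B : 'M[R]_(n, p))
    (t0 tf : R) (x : 'cV[{poly R}]_n) (u : 'cV[{poly R}]_p) :
  map_mx (@deriv R) x = map_mx polyC A *m x + map_mx polyC B *m u ->
  admissible t0 tf (pvec_eval u) /\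
  trajectory A B t0 tf (pvec_eval u) (pvec_eval x).
Proof.
move=> dx; split=> [i|i].
  rewrite (_ : (fun t => _) = EFin \o horner (u i 0)); last first.
    by apply/funext => t; rewrite mxE.
  apply: integrable_within_continuous; apply: continuous_subspaceT => t.
  exact: continuous_horner.
split.
  rewrite (_ : (fun t => _) = horner (x i 0)); last first.
    by apply/funext => t; rewrite mxE.
  by apply: continuous_subspaceT => t; exact: continuous_horner.
move=> t /andP[t0t _].
under eq_Rintegral => s _ do
  rewrite -!pvec_eval_constmul -pvec_evalD -dx !mxE.
by rewrite Rintegral_deriv_poly // !mxE addrCA subrr addr0.
Qed.

(** Without an uncontrollable mode the Kalman identity holds over the reals,
    since a real annihilator of all the [A^k B] would yield a complex mode; the
    identity then provides a polynomial control. *)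
Lemma no_mode_controllable (R : realType) n p (A : 'M[R]_n) (B : 'M[R]_(n, p)) :
  (forall (mu : R[i]) (v : 'rV[R[i]]_n),
     v *m complexmx A = mu *: v -> v *m complexmx B = 0 -> v = 0) ->
  controllable A B.
Proof.
case: n A B => [|n] A B nomode x0 xf t0 tf t0f.
  (* in dimension zero all states coincide *)
  exists (fun=> 0), (fun=> 0); split; last 2 first.
  - by apply/matrixP => -[].
  - by apply/matrixP => -[].
  - move=> i; rewrite (_ : (fun t => _) = cst 0%E) ?integrable0 //.
    by apply/funext => t; rewrite mxE.
  - by case.
have [[K sumK]|[v v0 vB]] := kalman_alternative A B; last first.
  have [|k|mu [w [w0 wA wB]]] := @annihilator_mode R[i] n p (complexmx A)
      (complexmx B) (complexmx v).
  - by rewrite map_mx_eq0.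
  - by rewrite -rmorphXn /= -!map_mxM vB map_mx0.
  - by rewrite (nomode mu w) ?eqxx in w0.
have t0f' : t0 != tf by rewrite lt_eqF.
have [x [u [dx <- <-]]] := polynomial_steering x0 xf t0f' sumK.
have [adm traj] := polynomial_trajectory t0 tf dx.
by exists (pvec_eval u), (pvec_eval x).
Qed.

Lemma hautus_test (R : realType) n p (A : 'M[R]_n) (B : 'M[R]_(n, p)) :
  controllable A B <->
  forall (mu : R[i]) (v : 'rV[R[i]]_n),
    v *m complexmx A = mu *: v -> v *m complexmx B = 0 -> v = 0.
Proof.
split=> [ctrl mu v vA vB|]; last exact: no_mode_controllable.
exact: controllable_no_mode ctrl vA vB.
Qed.

(** * Block row vectors and the network matrices *)

Section Blocks.
Variables (R : realType) (N : nat).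
Implicit Types n p : 'I_N -> nat.

Lemma complexmx_mxblock n p (M : forall i j, 'M[R]_(n i, p j)) :
  complexmx (\mxblock_(i, j) M i j) = \mxblock_(i, j) complexmx (M i j).
Proof. by apply/matrixP => k l; rewrite !mxE. Qed.

Lemma mxrow_mul_blockdiag n p m (v : forall i, 'M[R[i]]_(m, n i))
    (B : forall i, 'M[R]_(n i, p i)) :
  \mxrow_i v i *m complexmx (blockdiag B) = \mxrow_i (v i *m complexmx (B i)).
Proof.
rewrite complexmx_mxblock mul_mxrow_mxblock; apply: eq_mxrow => j.
rewrite (bigD1 j) //= eqxx conform_mx_id big1 ?addr0 // => i /negPf ->.
by rewrite /complexmx map_mx0 mulmx0.
Qed.

Lemma mxrow_mul_network n m (A : forall i, 'M[R]_(n i))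
    (C : forall i, 'M[R]_(m, n i)) (H : forall i, 'M[R]_(n i, m))
    (beta : 'I_N -> 'I_N -> R) (v : forall i, 'rV[R[i]]_(n i)) :
  \mxrow_i v i *m complexmx (network_state_mx A C H beta) =
  \mxrow_j (v j *m complexmx (A j) +
     \sum_i v i *m complexmx (beta i j *: (H i *m C j))).
Proof.
(* [mxdiag] is the square case of [blockdiag] *)
rewrite /complexmx map_mxD mulmxDr -!/(complexmx _) mxrow_mul_blockdiag.
by rewrite complexmx_mxblock mul_mxrow_mxblock -mxrowD.
Qed.

End Blocks.

Local Close Scope classical_set_scope.

(** * Star networks *)

(** As many independent eigenvectors as the geometric multiplicity form a basis
    of the eigenspace. *)
Lemma eigenvector_comb (F : fieldType) n g (M : 'M[F]_n) (mu : F)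
    (zeta : 'I_g -> 'rV[F]_n) (v : 'rV[F]_n) :
  g = geometric_multiplicity M mu ->
  (forall k, left_eigenvector M mu (zeta k)) ->
  row_free (\matrix_k zeta k) -> v *m M = mu *: v ->
  exists c, v = \sum_k c k *: zeta k.
Proof.
move=> gE eig free vM; set Z := \matrix_k _ in free.
have ZE : (Z <= eigenspace M mu)%MS.
  apply/row_subP => k; rewrite rowK; apply/eigenspaceP.
  by case: (eig k).
have : (v <= Z)%MS.
  have /andP[_ EZ] : (Z == eigenspace M mu)%MS.
    by rewrite -(geq_leqif (mxrank_leqif_eq ZE)) -[\rank _]gE (eqP free).
  by apply: submx_trans EZ; apply/eigenspaceP.
case/submxP=> c ->; exists (c 0); rewrite mulmx_sum_row.
by apply: eq_bigr => k _; rewrite rowK.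
Qed.

Theorem corollaryA3 (R : realType) (N m : nat) (n p : 'I_N -> nat)
    (n_gt0 : forall i, (0 < n i)%N)
    (A : forall i, 'M[R]_(n i)) (B : forall i, 'M[R]_(n i, p i))
    (C : forall i, 'M[R]_(m, n i)) (H : forall i, 'M[R]_(n i, m))
    (delta : 'I_N -> bool) (beta : 'I_N -> 'I_N -> R) (l : 'I_N)
    (star : star_topology beta l)
    (q : 'I_N -> nat) (mu : forall i, 'I_(q i) -> R[i])
    (mu_inj : forall i, injective (mu i))
    (mu_spectrum : forall (i : 'I_N) (z : R[i]),
        eigenvalue (complexmx (A i)) z <-> exists j, mu i j = z)
    (gamma : forall i, 'I_(q i) -> nat)
    (gammaE : forall i j,
        gamma i j = geometric_multiplicity (complexmx (A i)) (mu i j))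
    (zeta : forall i (j : 'I_(q i)), 'I_(gamma i j) -> 'rV[R[i]]_(n i))
    (zeta_eigen : forall i j k,
        left_eigenvector (complexmx (A i)) (mu i j) (zeta i j k))
    (zeta_free : forall i j, row_free (\matrix_k zeta i j k))
    (HC_after : forall i : 'I_N, (l < i)%N -> H i *m C l = 0)
    (HC_before : forall i : 'I_N, (i < l)%N -> forall j k,
        zeta i j k *m complexmx (H i) *m complexmx (C l) = 0) :
  controllable (network_state_mx A C H beta) (network_input_mx B delta)
  <->
  (forall i, controllable (A i) (B i)) /\ (forall i, delta i != false).
Proof.
have [_ beta0] := star.
(* the coupling block from the centre to [i] kills the eigenvectors of [A_i] *)
have HC i z (v : 'rV[R[i]]_(n i)) : i != l -> v *m complexmx (A i) = z *: v ->
    v *m complexmx (H i *m C l) = 0.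
  move=> il vA; have [li|] := ltnP l i.
    by rewrite HC_after // /complexmx map_mx0 mulmx0.
  rewrite leq_eqVlt -[_ == _]/(i == l) (negPf il) /= => li.
  have [->|v0] := eqVneq v 0; first by rewrite mul0mx.
  have [j muj] : exists j, mu i j = z.
    by apply/mu_spectrum/eigenvalueP; exists v.
  rewrite -muj in vA.
  have [c ->] :=
    eigenvector_comb (gammaE i j) (zeta_eigen i j) (zeta_free i j) vA.
  rewrite mulmx_suml; apply: big1 => k _; rewrite -scalemxAl.
  by rewrite [complexmx (_ *m _)]map_mxM mulmxA HC_before // scaler0.
have coupling0 z (v : forall i, 'rV[R[i]]_(n i)) j :
    (forall i, i != l -> v i *m complexmx (A i) = z *: v i) ->
    \sum_i v i *m complexmx (beta i j *: (H i *m C j)) = 0.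
  move=> vA; apply: big1 => i _.
  have [/andP[/eqP -> il]|ij] := boolP ((j == l) && (i != l)).
    rewrite /complexmx map_mxZ -scalemxAr -/(complexmx _).
    by rewrite (HC _ _ _ il (vA i il)) scaler0.
  by rewrite beta0 // scale0r /complexmx map_mx0 mulmx0.
have zrow z (v : forall i, 'rV[R[i]]_(n i)) :
    z *: (\mxrow_i v i) = \mxrow_i (z *: v i).
  by apply/rowP => k; rewrite !mxE.
rewrite hautus_test; split=> [hN|[hA hd]].
  have nomode i z (w : 'rV[R[i]]_(n i)) : w *m complexmx (A i) = z *: w ->
      w *m complexmx ((delta i)%:R *: B i) = 0 -> w = 0.
    move=> wA wB.
    (* extend [w] by zero to a row vector of the network; [conform_mx] is only
       a cast there *)
    pose v j : 'rV[R[i]]_(n j) := if i == j then conform_mx 0 w else 0.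
    have vi : v i = w by rewrite /v eqxx conform_mx_id.
    have vj j : i != j -> v j = 0 by move=> /negPf ij; rewrite /v ij.
    have vA j : v j *m complexmx (A j) = z *: v j.
      have [<-|/vj ->] := eqVneq i j; first by rewrite vi.
      by rewrite mul0mx scaler0.
    have vB j : v j *m complexmx ((delta j)%:R *: B j) = 0.
      by have [<-|/vj ->] := eqVneq i j; rewrite ?vi ?mul0mx.
    have /eq_mxrowP/(_ i) : \mxrow_j v j = \mxrow_j 0.
      rewrite mxrow0; apply: (hN z).
        rewrite mxrow_mul_network zrow; apply: eq_mxrow => j.
        by rewrite (coupling0 z) ?addr0.
      by rewrite mxrow_mul_blockdiag -[RHS]mxrow0; apply: eq_mxrow.
    by rewrite vi.
  split=> i.
    apply/hautus_test => z w wA wB; apply: (nomode i z w wA).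
    by rewrite /complexmx map_mxZ -scalemxAr -/(complexmx _) wB scaler0.
  (* without input, an eigenvector of [A_i] is an uncontrollable mode *)
  apply/negP => /eqP di; have [z /eigenvalueP[w wA]] :=
    spectral.eigenvalue_closed (complexmx (A i)) (n_gt0 i).
  apply/negP; rewrite negbK; apply/eqP/(nomode i z w wA).
  by rewrite di scale0r /complexmx map_mx0 mulmx0.
move=> z v vA vB.
pose w i : 'rV[R[i]]_(n i) := submxrow v i.
have vE : v = \mxrow_i w i by rewrite submxrowK.
rewrite vE in vA vB *.
rewrite mxrow_mul_network zrow in vA.
rewrite mxrow_mul_blockdiag in vB.
(* block column [i] of the coupling is zero unless [i] is the centre *)
have wAl i : i != l -> w i *m complexmx (A i) = z *: w i.
  move=> il; have /eq_mxrowP/(_ i) <- := vA.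
  rewrite big1 ?addr0 // => j _.
  by rewrite beta0 ?(negPf il) // scale0r /complexmx map_mx0 mulmx0.
rewrite -[RHS](@mxrow0 _ _ _ 1); apply: eq_mxrow => i.
apply: ((hautus_test (A i) (B i)).1 (hA i) z).
  by have /eq_mxrowP/(_ i) <- := vA; rewrite (coupling0 z) ?addr0.
have /eqP : w i *m complexmx ((delta i)%:R *: B i) = 0.
  by have /eq_mxrowP/(_ i) := etrans vB (esym (mxrow0 _)).
by move: (hd i); case: (delta i) => // _ /eqP; rewrite scale1r.
Qed.
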